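(* Let $H$ be a finite-dimensional Hilbert space, and let $S,\widehat S\subset B(H)$ be concrete Hopf C*-subalgebras associated with a multiplicative unitary $V\in \widehat S\otimes S\subset B(H\otimes H)$. Let $u$ be a unitary such that $x\mapsto uxu^*$ gives a Hopf algebra automorphism of $S$ whose action on the dual $\widehat S$ is inner. Then there exists a unitary $\widehat u\in\widehat S$ such that $\widehat u\otimes u$ commutes with $V$.
   Context: A multiplicative unitary on a finite-dimensional Hilbert space $H$ is a unitary $V\in B(H\otimes H)$ satisfying the pentagon relation $V_{12}V_{13}V_{23}=V_{23}V_{12}$ (leg notation on $H\otimes H\otimes H$). The associated concrete Hopf C*-subalgebras of $B(H)$ are $S=\{(\omega\otimes \mathrm{Id})(V):\omega\in B(H)^*\}$ and $\widehat S=\{(\mathrm{Id}\otimes\rho)(V):\rho\in B(H)^*\}$, with $V\in\widehat S\otimes S$; the coproducts are $\delta(x)=V(x\otimes 1)V^*$ on $S$ and $\widehat\delta(y)=V^*(1\otimes y)V$ on $\widehat S$. They are finite-dimensional Hopf C*-algebras in duality via the nondegenerate pairing $\beta\big((\omega\otimes\mathrm{Id})(V),(\mathrm{Id}\otimes\rho)(V)\big)=(\omega\otimes\rho)(V)$. A Hopf algebra automorphism of $S$ is a bijective algebra automorphism compatible with coproduct, counit and antipode. If $\alpha$ is a Hopf algebra automorphism of $S$, its action on the dual is the map $\widehat\alpha:\widehat S\to\widehat S$ determined by $\beta(\alpha(x),\widehat\alpha(y))=\beta(x,y)$ for all $x\in S$, $y\in\widehat S$. It is called inner if it has the form $y\mapsto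 \widehat w y\widehat w^*$ for some unitary $\widehat w\in\widehat S$. *)

(* Defs.v *)
From HB Require Import structures.
From mathcomp Require Import all_boot all_order all_algebra.
From mathcomp Require Export complex mxtens.
From mathcomp Require Export reals.

Set Implicit Arguments.
Unset Strict Implicit.
Unset Printing Implicit Defensive.

Import GRing.Theory Num.Theory.
Local Open Scope ring_scope.
Local Open Scope sesquilinear_scope.

(* The Hilbert space H is C^n, B(H) is 'M[C]_n and B(H (x) H) is 'M[C]_(n * n),
   with A (x) B the Kronecker product A *t B of mxtens; the basis vector
   e_i (x) e_j of H (x) H has index mxtens_index (i, j). *)

Section Tensor.
Variables (C : numClosedFieldType) (n : nat).

Local Notation "<< i , j >>" := (mxtens_index (i, j)) (format "<< i ,  j >>").

Local Notation dual := 'Hom('M[C]_n, C^o).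

(* lslice T w = (w (x) Id)(T) and rslice T r = (Id (x) r)(T). *)
Definition lslice (T : 'M[C]_(n * n)) (w : dual) : 'M[C]_n :=
  \matrix_(k, l) w (\matrix_(i, j) T <<i, k>> <<j, l>>).

Definition rslice (T : 'M[C]_(n * n)) (r : dual) : 'M[C]_n :=
  \matrix_(i, j) r (\matrix_(k, l) T <<i, k>> <<j, l>>).

(* (w (x) r)(T) *)
Definition form_tens (w r : dual) (T : 'M[C]_(n * n)) : C := r (lslice T w).

(* (f (x) g)(T) *)
Definition map_tens (f g : 'End('M[C]_n)) (T : 'M[C]_(n * n)) : 'M[C]_(n * n) :=
  \sum_i \sum_j \sum_k \sum_l
    T <<i, k>> <<j, l>> *: (f (delta_mx i j) *t g (delta_mx k l)).

(* The multiplication map A (x) B |-> A B, extended to B(H (x) H). *)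
Definition mult_tens (T : 'M[C]_(n * n)) : 'M[C]_n :=
  \matrix_(i, l) \sum_j T <<i, j>> <<j, l>>.

Definition flip : 'M[C]_(n * n) :=
  \matrix_(a, b) ((mxtens_unindex a == ((mxtens_unindex b).2,
                                        (mxtens_unindex b).1))%:R).

Definition leg12 (V : 'M[C]_(n * n)) : 'M[C]_(n * n * n) := V *t 1%:M.

Definition leg23 (V : 'M[C]_(n * n)) : 'M[C]_(n * n * n) :=
  castmx (mulnA n n n, mulnA n n n) (1%:M *t V).

Definition leg13 (V : 'M[C]_(n * n)) : 'M[C]_(n * n * n) :=
  leg23 flip *m leg12 V *m leg23 flip.

Lemma lslice_tens A B w : lslice (A *t B) w = w A *: B.
Proof.
apply/matrixP => k l; rewrite !mxE.
have -> : \matrix_(i, j) (A *t B) <<i, k>> <<j, l>> = B k l *: A.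
  by apply/matrixP => i j; rewrite !mxE !mxtens_indexK mulrC.
by rewrite linearZ /= /GRing.scale /= mulrC.
Qed.

Lemma rslice_tens A B r : rslice (A *t B) r = r B *: A.
Proof.
apply/matrixP => i j; rewrite !mxE.
have -> : \matrix_(k, l) (A *t B) <<i, k>> <<j, l>> = A i j *: B.
  by apply/matrixP => k l; rewrite !mxE !mxtens_indexK.
by rewrite linearZ /= /GRing.scale /= mulrC.
Qed.

Lemma form_tens_tens w r A B : form_tens w r (A *t B) = w A * r B.
Proof. by rewrite /form_tens lslice_tens linearZ. Qed.

Lemma mult_tens_tens A B : mult_tens (A *t B) = A *m B.
Proof.
by apply/matrixP => i l; rewrite !mxE; apply: eq_bigr => j _; rewrite tensmxE.
Qed.

Fact lslice_is_linear T : linear (lslice T).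
Proof.
move=> a w w'; apply/matrixP => k l; rewrite !mxE.
by rewrite add_lfunE scale_lfunE.
Qed.
HB.instance Definition _ T :=
  GRing.isLinear.Build C dual 'M[C]_n *:%R (lslice T) (lslice_is_linear T).

Fact rslice_is_linear T : linear (rslice T).
Proof.
move=> a w w'; apply/matrixP => k l; rewrite !mxE.
by rewrite add_lfunE scale_lfunE.
Qed.
HB.instance Definition _ T :=
  GRing.isLinear.Build C dual 'M[C]_n *:%R (rslice T) (rslice_is_linear T).

Lemma form_tensE w r T : form_tens w r T = w (rslice T r).
Proof.
pose E i j : 'M[C]_n := \matrix_(k, l) T <<i, k>> <<j, l>>.
have wE (M : 'M[C]_n) : w M = \sum_i \sum_j M i j * w (delta_mx i j).
  rewrite {1}[M]matrix_sum_delta linear_sum; apply: eq_bigr => i _.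
  by rewrite linear_sum; apply: eq_bigr => j _; rewrite linearZ.
have -> : w (rslice T r) = \sum_i \sum_j r (E i j) * w (delta_mx i j).
  by rewrite wE; apply: eq_bigr => i _; apply: eq_bigr => j _; rewrite mxE.
have lE : lslice T w = \sum_i \sum_j w (delta_mx i j) *: E i j.
  apply/matrixP => k l; rewrite mxE wE summxE; apply: eq_bigr => i _.
  by rewrite summxE; apply: eq_bigr => j _; rewrite !mxE mulrC.
rewrite /form_tens lE linear_sum; apply: eq_bigr => i _.
by rewrite linear_sum; apply: eq_bigr => j _; rewrite linearZ /= mulrC.
Qed.

Lemma map_tens_tens f g A B : map_tens f g (A *t B) = f A *t g B.
Proof.
have tE (h : 'End('M[C]_n)) (M : 'M[C]_n) :
    h M = \sum_i \sum_j M i j *: h (delta_mx i j).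
  rewrite {1}[M]matrix_sum_delta linear_sum; apply: eq_bigr => i _.
  by rewrite linear_sum; apply: eq_bigr => j _; rewrite linearZ.
apply/matrixP => a b; case: (mxtens_indexP a) => p q.
case: (mxtens_indexP b) => p' q'; rewrite tensmxE (tE f A) (tE g B).
rewrite /map_tens !summxE mulr_suml; apply: eq_bigr => i _.
rewrite !summxE mulr_suml; apply: eq_bigr => j _.
rewrite !summxE mulr_sumr; apply: eq_bigr => k _.
rewrite !summxE mulr_sumr; apply: eq_bigr => l _.
by rewrite [LHS]mxE !tensmxE !mxE mulrACA.
Qed.

Lemma tensmxA (A B D : 'M[C]_n) :
  castmx (mulnA n n n, mulnA n n n) (A *t (B *t D)) = A *t B *t D.
Proof.
apply/matrixP => a b; case: (mxtens_indexP a) => ij k.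
case: (mxtens_indexP ij) => i j; case: (mxtens_indexP b) => ij' k'.
case: (mxtens_indexP ij') => i' j'.
rewrite castmxE /= !tensmxE.
have cE (x y z : 'I_n) :
    cast_ord (esym (mulnA n n n)) (mxtens_index (mxtens_index (x, y), z))
    = mxtens_index (x, mxtens_index (y, z)).
  by apply: val_inj; rewrite /= mulnDl addnA mulnA.
by rewrite !cE !tensmxE mulrA.
Qed.

Lemma leg23_tens A B : leg23 (A *t B) = 1%:M *t A *t B.
Proof. exact: tensmxA. Qed.

Lemma flip_tens A B : flip *m (A *t B) *m flip = B *t A.
Proof.
have fE (x y : 'I_n * 'I_n) :
    flip (mxtens_index x) (mxtens_index y) = (x == (y.2, y.1))%:R.
  by rewrite mxE !mxtens_indexK.
apply/matrixP => a b; case: (mxtens_indexP a) => i k.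
case: (mxtens_indexP b) => j l; rewrite tensmxE mxE.
rewrite (bigD1 (mxtens_index (l, j))) //= fE eqxx mulr1 big1 ?addr0; last first.
  move=> c; case: (mxtens_indexP c) => p q neq; rewrite fE /=.
  case: eqP => [e|_]; last by rewrite mulr0.
  by rewrite e eqxx in neq.
rewrite mxE (bigD1 (mxtens_index (k, i))) //= fE eqxx mul1r tensmxE.
rewrite big1 ?addr0 1?mulrC // => c; case: (mxtens_indexP c) => p q neq.
rewrite fE /=; case: eqP => [[e1 e2]|_]; last by rewrite mul0r.
by rewrite e1 e2 eqxx in neq.
Qed.

Lemma leg13_tens A B : leg13 (A *t B) = A *t 1%:M *t B.
Proof.
rewrite /leg13 /leg12 -!tensmxA /leg23 -[LHS](castmxKV (mulnA n n n) (mulnA n n n)).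
congr castmx; rewrite -(flip_tens B 1%:M).
have -> : A *t (flip *m (B *t 1%:M) *m flip) =
    (1%:M *t flip) *m (A *t (B *t 1%:M)) *m (1%:M *t flip).
  by rewrite !tensmx_mul mul1mx mulmx1.
by case: _ / (mulnA n n n); rewrite !castmx_id.
Qed.

End Tensor.

Section MultiplicativeUnitary.
Variables (C : numClosedFieldType) (n : nat).
Implicit Types (V : 'M[C]_(n * n)) (u x y : 'M[C]_n) (a : 'End('M[C]_n)).

Definition multiplicative_unitary V : Prop :=
  V \is unitarymx /\ leg12 V *m leg13 V *m leg23 V = leg23 V *m leg12 V.

(* Salg = {(w (x) Id)(V)} and Shat = {(Id (x) r)(V)}; see memSalg and memShat. *)
Definition Salg V : {vspace 'M[C]_n} := limg (linfun (lslice V)).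
Definition Shat V : {vspace 'M[C]_n} := limg (linfun (rslice V)).

Definition coprod V x : 'M[C]_(n * n) := V *m (x *t 1%:M) *m V^t*.

(* ^-1 selects preimages under the slice maps; by pairingE the value does not
   depend on the selection.  Meaningful for x in Salg V and y in Shat V. *)
Definition pairing V x y : C :=
  form_tens ((linfun (lslice V))^-1%VF x) ((linfun (rslice V))^-1%VF y) V.

(* Linear maps between subspaces of B(H) are represented by linear maps on
   B(H), of which only the restriction to the subspace matters. *)
Definition is_counit V (e : 'Hom('M[C]_n, C^o)) : Prop :=
  {in Salg V, forall x, lslice (coprod V x) e = x /\ rslice (coprod V x) e = x}.

Definition is_antipode V (e : 'Hom('M[C]_n, C^o)) (k : 'End('M[C]_n)) : Prop :=
  {in Salg V, forall x,
    [/\ k x \in Salg V,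
        mult_tens (map_tens k \1%VF (coprod V x)) = (e x)%:M
      & mult_tens (map_tens \1%VF k (coprod V x)) = (e x)%:M]}.

(* The counit and the antipode are unique on Salg V, so quantifying over all of
   them is the same as naming them. *)
Record hopf_automorphism V a : Prop := HopfAutomorphism {
  hopf_aut_inj : {in Salg V &, injective a};
  hopf_aut_img : (a @: Salg V)%VS = Salg V;
  hopf_aut_mul : {in Salg V &, {morph a : x y / x *m y}};
  hopf_aut_one : a 1%:M = 1%:M;
  hopf_aut_coprod : {in Salg V, forall x, coprod V (a x) = map_tens a a (coprod V x)};
  hopf_aut_counit : forall e, is_counit V e -> {in Salg V, forall x, e (a x) = e x};
  hopf_aut_antipode : forall e k, is_counit V e -> is_antipode V e k ->
    {in Salg V, forall x, k (a x) = a (k x)} }.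

Definition Ad u : 'End('M[C]_n) := linfun (fun x => u *m x *m u^t*).

Definition dual_action V a (ahat : 'M[C]_n -> 'M[C]_n) : Prop :=
  {in Shat V, forall y, ahat y \in Shat V} /\
  {in Salg V & Shat V, forall x y, pairing V (a x) (ahat y) = pairing V x y}.

Definition inner_on_Shat V (ahat : 'M[C]_n -> 'M[C]_n) : Prop :=
  exists w : 'M[C]_n, [/\ w \is unitarymx, w \in Shat V
    & {in Shat V, forall y, ahat y = w *m y *m w^t*}].

Lemma memSalg V x : reflect (exists w, x = lslice V w) (x \in Salg V).
Proof.
apply: (iffP memv_imgP) => [[w _ ->]|[w ->]]; exists w; rewrite ?lfunE //.
exact: memvf.
Qed.

Lemma memShat V y : reflect (exists r, y = rslice V r) (y \in Shat V).
Proof.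
apply: (iffP memv_imgP) => [[w _ ->]|[w ->]]; exists w; rewrite ?lfunE //.
exact: memvf.
Qed.

Lemma pairingE V w r : pairing V (lslice V w) (rslice V r) = form_tens w r V.
Proof.
have lK : lslice V ((linfun (lslice V))^-1%VF (lslice V w)) = lslice V w.
  by rewrite -[LHS]lfunE limg_lfunVK //; apply/memSalg; exists w.
have rK : rslice V ((linfun (rslice V))^-1%VF (rslice V r)) = rslice V r.
  by rewrite -[LHS]lfunE limg_lfunVK //; apply/memShat; exists r.
by rewrite /pairing form_tensE rK -form_tensE /form_tens lK.
Qed.

Lemma AdE u x : Ad u x = u *m x *m u^t*.
Proof. by rewrite (lfunE (mulmxr (u^t*) \o mulmx u)). Qed.

End MultiplicativeUnitary.

(* Main.v *)
Require Import Defs.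
From HB Require Import structures.
From mathcomp Require Import all_boot all_order all_algebra.
From mathcomp Require Import complex mxtens reals.

Set Implicit Arguments.
Unset Strict Implicit.
Unset Printing Implicit Defensive.

Import GRing.Theory Num.Theory.
Local Open Scope ring_scope.

(* V is the canonical element of the pairing between S and its dual, so it is
   fixed by the tensor product of any automorphism of S with its dual action.
   When these are implemented by u and by a unitary w of the dual, this says
   that w (x) u commutes with V. *)

Lemma tensmx1 (K : pzRingType) (m n : nat) :
  1%:M *t 1%:M = 1%:M :> 'M[K]_(m * n).
Proof.
apply/matrixP => a b; case: (mxtens_indexP a) => i k.
case: (mxtens_indexP b) => j l; rewrite tensmxE !mxE -natrM mulnb.
by rewrite (can_eq (@mxtens_indexK m n)).
Qed.

Lemma tens_sum_delta (K : numClosedFieldType) (n : nat) (T : 'M[K]_(n * n)) :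
  T = \sum_i \sum_j \sum_k \sum_l
        T (mxtens_index (i, k)) (mxtens_index (j, l)) *:
          (delta_mx i j *t delta_mx k l).
Proof.
apply/matrixP => a b; case: (mxtens_indexP a) => i k.
case: (mxtens_indexP b) => j l; symmetry.
rewrite summxE (bigD1 i) //= summxE (bigD1 j) //= summxE (bigD1 k) //=.
rewrite summxE (bigD1 l) //= !big1 ?addr0.
- by rewrite mxE tensmxE !mxE !eqxx !mulr1.
- move=> i' ne; rewrite summxE big1 // => j' _; rewrite summxE big1 // => k' _.
  rewrite summxE big1 // => l' _.
  by rewrite mxE tensmxE !mxE [i == i']eq_sym (negPf ne) mul0r mulr0.
- move=> j' ne; rewrite summxE big1 // => k' _; rewrite summxE big1 // => l' _.
  by rewrite mxE tensmxE !mxE [j == j']eq_sym (negPf ne) andbF mul0r mulr0.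
- move=> k' ne; rewrite summxE big1 // => l' _.
  by rewrite mxE tensmxE !mxE [k == k']eq_sym (negPf ne) !mulr0.
- move=> l' ne.
  by rewrite mxE tensmxE !mxE [l == l']eq_sym (negPf ne) andbF !mulr0.
Qed.

(** Tensors of matrix units span B(H (x) H), so identities between linear maps need only be checked
    on elementary tensors. *)
Lemma eq_linear_tens (K : numClosedFieldType) (n : nat) (W : lmodType K)
    (f g : {linear 'M[K]_(n * n) -> W}) :
  (forall A B, f (A *t B) = g (A *t B)) -> f =1 g.
Proof.
move=> fg T; rewrite (tens_sum_delta T) !linear_sum; apply: eq_bigr => i _.
rewrite !linear_sum; apply: eq_bigr => j _; rewrite !linear_sum.
apply: eq_bigr => k _; rewrite !linear_sum; apply: eq_bigr => l _.
by rewrite !linearZ fg.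
Qed.

Fact form_tens_is_linear (K : numClosedFieldType) (n : nat)
    (w r : 'Hom('M[K]_n, K^o)) : linear (form_tens w r : _ -> K^o).
Proof.
move=> a S T; rewrite /form_tens.
have -> : lslice (a *: S + T) w = a *: lslice S w + lslice T w; last exact: linearP.
apply/matrixP => k l; rewrite !mxE -[RHS]linearP; congr (w _).
by apply/matrixP => i j; rewrite !mxE.
Qed.
HB.instance Definition _ (K : numClosedFieldType) (n : nat)
    (w r : 'Hom('M[K]_n, K^o)) :=
  GRing.isLinear.Build K 'M[K]_(n * n) K^o *:%R (form_tens w r)
    (form_tens_is_linear w r).

(** Moves a conjugation of the tensor onto the functionals. Both sides are linear in [T], and on
    [A *t B] each leg is conjugated separately. *)
Lemma form_tens_conj (K : numClosedFieldType) (n : nat)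
    (w r : 'Hom('M[K]_n, K^o)) (a b : 'M[K]_n) (T : 'M[K]_(n * n)) :
  form_tens w r ((a *t b) *m T *m (a^t* *t b^t*)%sesqui) =
  form_tens (w \o Ad a)%VF (r \o Ad b)%VF T.
Proof.
pose F (w' r' : 'Hom('M[K]_n, K^o)) : {linear 'M[K]_(n * n) -> K^o} :=
  form_tens w' r'.
pose c : {linear 'M[K]_(n * n) -> 'M[K]_(n * n)} :=
  mulmxr (a^t* *t b^t*)%sesqui \o mulmx (a *t b).
apply: (@eq_linear_tens _ _ _ (F w r \o c) (F (w \o Ad a)%VF (r \o Ad b)%VF)).
move=> A B /=.
by rewrite !tensmx_mul !form_tens_tens !comp_lfunE !AdE.
Qed.

(** Products of coordinate functionals already read off every matrix entry, so product functionals
    separate points. *)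
Lemma form_tens_inj (K : numClosedFieldType) (n : nat) (S T : 'M[K]_(n * n)) :
  (forall w r, form_tens w r S = form_tens w r T) -> S = T.
Proof.
move=> eqST; apply/matrixP => a b; case: (mxtens_indexP a) => i k.
case: (mxtens_indexP b) => j l.
pose coord (p q : 'I_n) : 'Hom('M[K]_n, K^o) :=
  linfun ((fun M => M p q) : 'M[K]_n -> K^o).
have coordE p q M : coord p q M = M p q.
  (* [linfun] accepts any function but computes as expected only on linear ones, so the linear
     structure is built by hand for [lfunE]. *)
  have lin : linear ((fun M => M p q) : 'M[K]_n -> K^o).
    by move=> c X Y; rewrite !mxE.
  pose f := GRing.isLinear.Build _ _ _ _ _ lin.
  pose F : {linear 'M[K]_n -> K^o} := HB.pack (fun M : 'M[K]_n => M p q : K^o) f.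
  exact: (lfunE F M).
by have := eqST (coord i j) (coord k l); rewrite /form_tens !coordE !mxE !coordE !mxE.
Qed.

(** Invariance of V under b (x) a, tested on product functionals. It is the relation β(a(x),
    ahat(y)) = β(x, y) for suitable slices x and y of V, with [b] a linear map agreeing with [ahat]
    on the dual. *)
Lemma form_tens_automorphism (K : numClosedFieldType) (n : nat)
    (V : 'M[K]_(n * n)) (a : 'End('M[K]_n)) (ahat : 'M[K]_n -> 'M[K]_n)
    (b : 'End('M[K]_n)) (w r : 'Hom('M[K]_n, K^o)) :
  (a @: Salg V)%VS = Salg V -> dual_action V a ahat ->
  {in Shat V, ahat =1 b} ->
  form_tens (w \o b)%VF (r \o a)%VF V = form_tens w r V.
Proof.
move=> imga [ahatS ahatP] ahatE.
(* The slice y = (Id (x) r∘a)(V) is chosen so that β(x, y) = r(a(x)). *)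
have yS : rslice V (r \o a)%VF \in Shat V by apply/memShat; exists (r \o a)%VF.
have /memShat[r' yE] := ahatS _ yS.
(* Surjectivity of [a] on S provides x with a(x) = (w (x) Id)(V), so that β(a(x), ahat(y)) =
   w(ahat(y)). *)
have : lslice V w \in (a @: Salg V)%VS by rewrite imga; apply/memSalg; exists w.
case/memv_imgP => x xS xE; have /memSalg[w' x'E] := xS.
have := ahatP _ _ xS yS; rewrite -xE yE pairingE x'E pairingE form_tensE -yE.
rewrite ahatE // => E; rewrite form_tensE comp_lfunE E /form_tens comp_lfunE.
by rewrite -x'E -xE.
Qed.

Theorem theorem3p1 (R : realType) (n : nat) (V : 'M[R[i]]_(n * n))
    (hV : multiplicative_unitary V)
    (u : 'M[R[i]]_n) (hu : u \is unitarymx)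
    (haut : hopf_automorphism V (Ad u))
    (ahat : 'M[R[i]]_n -> 'M[R[i]]_n)
    (hdual : dual_action V (Ad u) ahat)
    (hinner : inner_on_Shat V ahat) :
  exists uhat : 'M[R[i]]_n,
    [/\ uhat \is unitarymx, uhat \in Shat V & comm_mx (uhat *t u) V].
Proof.
have [w [w_unitary wS ahatE]] := hinner; exists w; split=> //.
(* The inner dual action agrees on the dual with the linear map [Ad w], which serves as [b] in the
   weak invariance. *)
have fixV : (w *t u) *m V *m (w^t* *t u^t*)%sesqui = V.
  apply: form_tens_inj => f r; rewrite form_tens_conj.
  apply: form_tens_automorphism hdual _; first exact: hopf_aut_img haut.
  by move=> y yS; rewrite ahatE // AdE.
have unitaryKC (a : 'M[R[i]]_n) : a \is unitarymx -> (a^t*)%sesqui *m a = 1%:M.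
  by move=> /unitarymxP /mulmx1C.
(* Expanding only the right-hand V by [fixV] lets the adjoint factor cancel against [w *t u]. *)
rewrite /comm_mx -[in RHS]fixV -[RHS]mulmxA tensmx_mul !unitaryKC //.
by rewrite tensmx1 mulmx1.
Qed.
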